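(* For each infinite-dimensional reflexive real Banach space $E$, there exists at least one coercive Lipschitz function $f: E\to\mathbb{R}$ such that $f$ is not s.w.l.s.c.
   Context: All Banach spaces are over $\mathbb{R}$. A function $f: E\to\mathbb{R}$ on an (unbounded) normed space $E$ is coercive if $f(x)\to+\infty$ as $\|x\|\to+\infty$. It is s.w.l.s.c. (sequentially weakly lower semicontinuous) if $\liminf_n f(x_n)\geq f(x)$ for every $x\in E$ and every sequence $(x_n)$ in $E$ converging weakly to $x$. *)

(* Defs.v *)
From HB Require Import structures.
From mathcomp Require Import all_boot all_order all_algebra.
From mathcomp Require Import all_classical all_reals all_analysis.

Set Implicit Arguments.
Unset Strict Implicit.
Unset Printing Implicit Defensive.

Import Order.TTheory GRing.Theory Num.Theory.
Import numFieldNormedType.Exports.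

Local Open Scope classical_set_scope.
Local Open Scope ring_scope.

Section Dual.
Variables (R : realType) (E : normedModType R).

Definition is_dual (g : E -> R^o) : Prop := linear g /\ continuous g.

Definition dual_pred : {pred (E -> R^o)} := fun g => `[< is_dual g >].

Lemma dual_predP (g : E -> R^o) : reflect (is_dual g) (g \in dual_pred).
Proof. exact: asboolP. Qed.

Lemma dual_submod_closed : submod_closed dual_pred.
Proof.
split=> [|a g h /dual_predP[lg cg] /dual_predP[lh ch]]; apply/dual_predP; split.
- by move=> b x y /=; rewrite scaler0 addr0.
- exact: cst_continuous.
- move=> b x y; rewrite !fctE lg lh !scalerDr !scalerA [b * a]mulrC.
  by rewrite addrACA.
- by move=> x; apply: cvgD; [apply: cvgZl_tmp; exact: cg|exact: ch].
Qed.

HB.instance Definition _ :=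
  GRing.isSubmodClosed.Build R (E -> R^o) dual_pred dual_submod_closed.

Record dual : Type :=
  Dual { dual_fun :> E -> R^o; dual_funP : dual_fun \in dual_pred }.

HB.instance Definition _ := [isSub for dual_fun].
HB.instance Definition _ := [Choice of dual by <:].
HB.instance Definition _ := [SubChoice_isSubZmodule of dual by <:].
HB.instance Definition _ := [SubZmodule_isSubLmodule of dual by <:].

Lemma dual_linear (g : dual) : linear g.
Proof. by have /dual_predP[] := dual_funP g. Qed.

Lemma dual_continuous (g : dual) : continuous g.
Proof. by have /dual_predP[] := dual_funP g. Qed.

HB.instance Definition _ (g : dual) :=
  GRing.isLinear.Build R E R^o *:%R (dual_fun g) (dual_linear g).

Definition dual_norm (g : dual) : R :=
  sup [set `|g x| | x in [set x : E | `|x| <= 1]].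

Lemma dual_norm_has_sup (g : dual) :
  has_sup [set `|g x| | x in [set x : E | `|x| <= 1]].
Proof.
split; first by exists `|g 0|, 0 => //=; rewrite normr0.
have /bounded_funP/(_ 1)[M gM] :=
  continuous_linear_bounded 0 (@dual_continuous g 0).
by exists M => _ [x /= x1 <-]; exact: gM.
Qed.

Lemma dual_norm_ub (g : dual) (x : E) : `|x| <= 1 -> `|g x| <= dual_norm g.
Proof.
move=> x1; apply: ub_le_sup; first by case: (dual_norm_has_sup g).
by exists x.
Qed.

Lemma dual_norm_le (g : dual) (M : R) :
  (forall x : E, `|x| <= 1 -> `|g x| <= M) -> dual_norm g <= M.
Proof.
move=> gM; apply: ge_sup; first by case: (dual_norm_has_sup g).
by move=> _ [x /= x1 <-]; exact: gM.
Qed.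

Lemma ler_dual_norm (g : dual) (x : E) : `|g x| <= dual_norm g * `|x|.
Proof.
have [->|x0] := eqVneq x 0; first by rewrite linear0 !normr0 mulr0.
have nx0 : 0 < `|x| by rewrite normr_gt0.
rewrite -ler_pdivrMr// mulrC -[X in X * _](@ger0_norm _ `|x|^-1) ?invr_ge0//.
have -> : `| `|x|^-1 | * `|g x| = `|g (`|x|^-1 *: x)| by rewrite linearZ normrM.
by apply: dual_norm_ub; rewrite normrZ ger0_norm ?invr_ge0// mulVf ?gt_eqF.
Qed.

Lemma dual_normD (g h : dual) :
  dual_norm (g + h) <= dual_norm g + dual_norm h.
Proof.
apply: dual_norm_le => x x1.
by rewrite (le_trans (ler_normD _ _))// lerD// dual_norm_ub.
Qed.

Lemma dual_normZ (a : R) (g : dual) : dual_norm (a *: g) = `|a| * dual_norm g.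
Proof.
have leZ b h : dual_norm (b *: h) <= `|b| * dual_norm h.
  by apply: dual_norm_le => x x1; rewrite normrM ler_wpM2l// dual_norm_ub.
apply/eqP; rewrite eq_le leZ/=.
have [->|a0] := eqVneq a 0.
  rewrite normr0 mul0r (le_trans (normr_ge0 ((0 *: g : dual) 0)))//.
  by apply: dual_norm_ub; rewrite normr0.
rewrite -ler_pdivlMl ?normr_gt0// -normfV.
by rewrite (le_trans _ (leZ _ _))// scalerA mulVf// scale1r.
Qed.

Lemma dual_norm0_eq0 (g : dual) : dual_norm g = 0 -> g = 0.
Proof.
move=> g0; apply/val_inj/funext => x /=; apply/eqP; rewrite -normr_le0.
by rewrite (le_trans (ler_dual_norm g x))// g0 mul0r.
Qed.

HB.instance Definition _ :=
  Lmodule_isNormed.Build R dual dual_normD dual_normZ dual_norm0_eq0.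

End Dual.

Section Reflexive.
Variables (R : realType) (E : normedModType R).

Definition ev (x : E) : dual E -> R^o := fun g => g x.

Lemma ev_dual (x : E) : ev x \in @dual_pred R (dual E).
Proof.
have lev : linear (ev x) by [].
pose L := GRing.isLinear.Build R (dual E) R^o *:%R (ev x) lev.
pose evL : {linear dual E -> R^o} := HB.pack (ev x) L.
apply/dual_predP; split => //.
apply: (@bounded_linear_continuous _ _ _ evL).
apply/bounded_funP => r; exists (r * `|x|) => g gr.
by rewrite (le_trans (ler_dual_norm g x))// ler_wpM2r.
Qed.

Definition canonical_embedding (x : E) : dual (dual E) := Dual (ev_dual x).

Definition reflexive_space : Prop :=
  forall phi : dual (dual E), exists x : E, canonical_embedding x = phi.

End Reflexive.

Arguments reflexive_space {R} E.

Definition finite_dimensional (R : realType) (E : lmodType R) : Prop :=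
  exists (n : nat) (e : 'I_n -> E), forall x : E,
    exists c : 'I_n -> R, x = \sum_(i < n) c i *: e i.

Arguments finite_dimensional {R} E.

Section Functions.
Variables (R : realType) (E : normedModType R).

Definition weakly_cvg (u : nat -> E) (x : E) : Prop :=
  forall g : dual E, g (u n) @[n --> \oo] --> g x.

(* [limn_einf] takes values in the extended reals: the real-valued [limn_inf]
   is only meaningful for bounded sequences. *)
Definition swlsc (f : E -> R) : Prop :=
  forall (x : E) (u : nat -> E), weakly_cvg u x ->
    ((f x)%:E <= limn_einf (fun n => (f (u n))%:E))%E.

(* x tends to this filter iff `|x| tends to +oo *)
Definition norm_pinfty : set_system E :=
  filter_from [set: R] (fun r => [set x : E | r < `|x|]).

Definition coercive (f : E -> R) : Prop := f x @[x --> norm_pinfty] --> +oo.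

End Functions.

(* Main.v *)
From HB Require Import structures.
Require Import Defs.
From mathcomp Require Import all_boot all_order all_algebra.
From mathcomp Require Import all_classical all_reals all_analysis.
From mathcomp Require Import lra.
Import Order.TTheory GRing.Theory Num.Theory.
Import numFieldNormedType.Exports.
Local Open Scope classical_set_scope.
Local Open Scope ring_scope.

(** The function is the distance to the range of a sequence of unit vectors
    [x n] that converges weakly to 0 ([weakly_null_unit_sequence]). A distance
    function is 1-Lipschitz; it is at least [|y| - 1], because the range is
    contained in the unit sphere, hence it is coercive; and it vanishes at all
    [x n] while its value at the weak limit 0 is 1.

    The sequence is built in the manner of Mazur's construction of basic
    sequences, with rational combinations in place of the compactness of
    finite-dimensional spheres. Each vector [d] has a norming functional [N d].
    The unit vector [x n] is taken in the common kernel of the functionals [N d]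
    of finitely many rational combinations [d] of the previous vectors, a kernel
    which is nonzero because [E] is infinite-dimensional
    ([unit_vector_in_kernels]); every rational combination is eventually
    included ([eventually_annihilated_sequence]). A weak cluster point [y] of
    the sequence is then annihilated by every [N d]. It also belongs to the
    closed linear span ([closure_span_of_dual]), where the vectors [d] are dense
    ([rat_comb_dense]), and this forces [y = 0]. Reflexivity makes bounded
    sequences converge weakly along ultrafilters ([ultrafilter_weak_limit]), so
    0 being the only cluster point means that the whole sequence converges
    weakly to 0.

    Norming functionals and the separation from a closed subspace come from
    the Hahn-Banach theorem for sublinear functionals, proved by showing that
    minimal sublinear functionals are linear ([minimal_linear]). *)

(** * Sublinear functionals and the Hahn-Banach theorem *)
Section Sublinear.
Context {R : realType} {E : lmodType R}.
Implicit Types (p q : E -> R) (V : set (E * R)).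

Definition sublinear q :=
  (forall x y, q (x + y) <= q x + q y) /\
  (forall t x, 0 <= t -> q (t *: x) <= t * q x).

Lemma sublinear0 q : sublinear q -> q 0 = 0.
Proof.
move=> [qD qZ]; have := qD 0 0; have := qZ 0 0 (lexx 0).
by rewrite scale0r mul0r addr0 => ? ?; lra.
Qed.

Lemma sublinear_geN q x : sublinear q -> - q (- x) <= q x.
Proof.
move=> sq; have := sq.1 x (- x); rewrite subrr (sublinear0 q sq) => ?; lra.
Qed.

(** The case to keep in mind is the graph of a positively homogeneous additive
    map dominated by [q] and defined on a convex cone of [E]; a set of pairs
    (vector, value) represents such partial maps without dependent types. *)
Definition cone_minorant q V :=
  [/\ V (0, 0),
      forall u w, V u -> V w -> V (u.1 + w.1, u.2 + w.2),
      forall t u, 0 <= t -> V u -> V (t *: u.1, t * u.2) &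
      forall u, V u -> u.2 <= q u.1].

(** When [V] is the graph of [h], this is the largest sublinear functional
    [r <= q] such that [r (- v) <= - h v] on the domain of [h]. For [q] the
    norm and [h] the zero map on a subspace, it is the distance to that
    subspace. *)
Definition inf_conv q V x := inf [set q (x + u.1) - u.2 | u in V].

Section InfConv.
Context {q : E -> R} {V : set (E * R)} (sq : sublinear q) (mV : cone_minorant q V).

Lemma inf_conv_le x u : V u -> inf_conv q V x <= q (x + u.1) - u.2.
Proof.
move=> Vu; apply: ge_inf; last by exists u.
exists (- q (- x)) => _ [w Vw <-]; have [_ _ _ /(_ w Vw)] := mV.
have := sq.1 (x + w.1) (- x); rewrite addrAC subrr add0r => ? ?; lra.
Qed.

Lemma le_inf_conv x r :
  (forall u, V u -> r <= q (x + u.1) - u.2) -> r <= inf_conv q V x.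
Proof.
move=> rV; apply: lb_le_inf => [|_ [u Vu <-]]; last exact: rV.
by have [V0 _ _ _] := mV; eexists; exists (0, 0).
Qed.

(** Being closed under sums and nonnegative scaling, the cone absorbs the
    translations produced by [x + y] and [t *: x]; this is what transfers
    sublinearity from [q] to the infimum. *)
Lemma inf_conv_sublinear : sublinear (inf_conv q V).
Proof.
have [V0 VD VZ _] := mV; split=> [x y|t x].
  suff H u w : V u -> V w -> inf_conv q V (x + y) <=
      (q (x + u.1) - u.2) + (q (y + w.1) - w.2).
    rewrite -lerBlDr; apply: le_inf_conv => u Vu; rewrite lerBlDr -lerBlDl.
    by apply: le_inf_conv => w Vw; rewrite lerBlDl; exact: H.
  move=> Vu Vw; apply: le_trans (inf_conv_le _ _ (VD _ _ Vu Vw)) _ => /=.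
  by have := sq.1 (x + u.1) (y + w.1); rewrite addrACA => ?; lra.
rewrite le_eqVlt => /predU1P[<-|t0].
  rewrite mul0r scale0r; apply: le_trans (inf_conv_le _ _ V0) _ => /=.
  by rewrite addr0 subr0 (sublinear0 q sq).
rewrite -ler_pdivrMl//; apply: le_inf_conv => u Vu; rewrite ler_pdivrMl//.
apply: le_trans (inf_conv_le _ _ (VZ _ _ (ltW t0) Vu)) _ => /=.
by rewrite -scalerDr mulrBr lerB// sq.2// ltW.
Qed.

Lemma inf_conv_le_self x : inf_conv q V x <= q x.
Proof.
have [V0 _ _ _] := mV.
by have := inf_conv_le x _ V0; rewrite /= addr0 subr0.
Qed.

Lemma inf_conv_opp u : V u -> inf_conv q V (- u.1) <= - u.2.
Proof.
move=> Vu; have := inf_conv_le (- u.1) _ Vu.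
by rewrite addNr (sublinear0 q sq) add0r.
Qed.

End InfConv.

Definition ray q y : set (E * R) :=
  [set (t *: y, t * q y) | t in [set t | 0 <= t]].

Lemma sublinear_ray_ge q y : sublinear q ->
  forall t, 0 <= t -> t * q y <= q (t *: y).
Proof.
move=> sq t; rewrite le_eqVlt => /predU1P[<-|t0].
  by rewrite mul0r scale0r (sublinear0 q sq).
rewrite -ler_pdivlMl//; have := sq.2 t^-1 (t *: y).
by rewrite scalerA mulVf ?gt_eqF// scale1r; apply; rewrite invr_ge0 ltW.
Qed.

Lemma cone_minorant_ray q y : sublinear q -> cone_minorant q (ray q y).
Proof.
move=> sq; split.
- by exists 0 => //=; rewrite scale0r mul0r.
- move=> _ _ [s s0 <-] [t t0 <-]; exists (s + t) => /=; first exact: addr_ge0.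
  by rewrite scalerDl mulrDl.
- move=> t _ t0 [s s0 <-]; exists (t * s) => /=; first exact: mulr_ge0.
  by rewrite scalerA mulrA.
- by move=> _ [t t0 <-] /=; exact: sublinear_ray_ge.
Qed.

Definition minimal q := forall r, sublinear r -> (forall x, r x <= q x) -> r = q.

(** Inf-convolving [q] with the ray through [y] cannot lower a minimal [q], so
    that [q x <= q (x + y) - q y] for all [x]: the reverse of subadditivity. *)
Lemma minimal_linear q : sublinear q -> minimal q -> linear (q : E -> R^o).
Proof.
move=> sq mq; have qD x y : q (x + y) = q x + q y.
  apply/eqP; rewrite eq_le sq.1 /=.
  have Vy := cone_minorant_ray q y sq.
  have eq_q := mq _ (inf_conv_sublinear sq Vy) (inf_conv_le_self sq Vy).
  have : ray q y (y, q y) by exists 1 => //=; rewrite scale1r mul1r.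
  by move=> /(inf_conv_le sq Vy x); rewrite eq_q /= => ?; lra.
have qN x : q (- x) = - q x.
  by have := qD x (- x); rewrite subrr (sublinear0 q sq) => ?; lra.
have qZp t x : 0 <= t -> q (t *: x) = t * q x.
  by move=> t0; apply/eqP; rewrite eq_le sq.2//= sublinear_ray_ge.
move=> t x y; rewrite qD; congr (_ + _).
have [t0|t0] := leP 0 t; first exact: qZp.
have := qZp (- t) x; rewrite oppr_ge0 scaleNr qN mulNr => /(_ (ltW t0)).
by move/oppr_inj.
Qed.

(** The lower bound of a chain required by Zorn's lemma. The pointwise infimum
    is finite because [- p (- x)] bounds all members from below, and it is
    subadditive because two members of a chain can be replaced by the smaller
    one. *)
Lemma sublinear_inf_chain (A : set (E -> R)) p : A !=set0 ->
  (forall q, A q -> sublinear q /\ forall x, q x <= p x) ->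
  (forall q r, A q -> A r -> (forall x, q x <= r x) \/ (forall x, r x <= q x)) ->
  exists q, [/\ sublinear q, (forall x, q x <= p x) &
                forall r, A r -> forall x, q x <= r x].
Proof.
move=> [q0 Aq0] Ap Atot; pose q x := inf [set r x | r in A].
have qle r x : A r -> q x <= r x.
  move=> Ar; apply: ge_inf; last by exists r.
  exists (- p (- x)) => _ [s As <-]; have [ss sp] := Ap _ As.
  by rewrite (le_trans _ (sublinear_geN _ _ ss))// lerN2 sp.
have geq_q x t : (forall r, A r -> t <= r x) -> t <= q x.
  move=> tA; apply: lb_le_inf => [|_ [r Ar <-]]; last exact: tA.
  by exists (q0 x), q0.
exists q; split; last by move=> r Ar x; exact: qle.
- split=> [x y|t x].
    suff H r s : A r -> A s -> q (x + y) <= r x + s y.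
      rewrite -lerBlDr; apply: (geq_q) => r Ar; rewrite lerBlDr -lerBlDl.
      by apply: (geq_q) => s As; rewrite lerBlDl; exact: H.
    move=> Ar As; have [rs|sr] := Atot _ _ Ar As.
      rewrite (le_trans (qle _ _ Ar))// (le_trans ((Ap _ Ar).1.1 _ _))//.
      by rewrite lerD2l.
    rewrite (le_trans (qle _ _ As))// (le_trans ((Ap _ As).1.1 _ _))//.
    by rewrite lerD2r.
  rewrite le_eqVlt => /predU1P[<-|t0].
    rewrite mul0r scale0r (le_trans (qle _ _ Aq0))//.
    by rewrite (sublinear0 _ (Ap _ Aq0).1).
  rewrite -ler_pdivrMl//; apply: (geq_q) => r Ar; rewrite ler_pdivrMl//.
  by rewrite (le_trans (qle _ _ Ar))// (Ap _ Ar).1.2// ltW.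
- by move=> x; rewrite (le_trans (qle _ _ Aq0))//; case: (Ap _ Aq0).
Qed.

Lemma exists_minimal p : sublinear p ->
  exists q, [/\ sublinear q, (forall x, q x <= p x) & minimal q].
Proof.
move=> sp; pose T := {q | sublinear q /\ forall x, q x <= p x}.
pose below (q r : T) : bool := `[< forall x, sval r x <= sval q x >].
have [||||[q [sq qp]] qmin] := @Zorn T below.
- by move=> q; apply/asboolP.
- move=> q r s /asboolP qr /asboolP rs; apply/asboolP => x.
  exact: le_trans (rs x) (qr x).
- move=> [q ?] [r ?] /asboolP /= qr /asboolP /= rq; apply: eq_exist.
  by apply/funext => x; apply/eqP; rewrite eq_le qr rq.
- move=> A Atot; have [[q0 Aq0]|A0] := pselect (A !=set0); last first.
    by exists (exist _ p (conj sp (fun=> lexx _))) => q Aq; case: A0; exists q.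
  have [|||q [sq qp qA]] := sublinear_inf_chain [set sval q | q in A] p.
  + by exists (sval q0), q0.
  + by move=> _ [q Aq <-]; exact: (svalP q).
  + move=> _ _ [q Aq <-] [r Ar <-].
    by have [/asboolP|/asboolP] := Atot _ _ Aq Ar; [right|left].
  exists (exist _ q (conj sq qp)) => r Ar; apply/asboolP => x /=.
  by apply: qA; exists r.
exists q; split=> // r sr rq.
have rp x : r x <= p x := le_trans (rq x) (qp x).
have qr : below (exist _ q (conj sq qp)) (exist _ r (conj sr rp)).
  exact/asboolP.
by have /(congr1 sval) := qmin _ qr.
Qed.

(** A linear functional below [p] may be far from [p] at [x0]. Starting
    instead from the inf-convolution of [p] with the ray through [x0] forces
    [g (- x0) <= - p x0], hence equality at [x0]. *)
Lemma hahn_banach_sublinear p x0 : sublinear p ->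
  exists g : E -> R^o, [/\ linear g, (forall x, g x <= p x) & g x0 = p x0].
Proof.
move=> sp; have Vx0 := cone_minorant_ray p x0 sp.
have [g [sg gp mg]] := exists_minimal _ (inf_conv_sublinear sp Vx0).
have lg := minimal_linear _ sg mg.
have glep x : g x <= p x := le_trans (gp x) (inf_conv_le_self sp Vx0 x).
exists g; split=> //; apply/eqP; rewrite eq_le glep /=.
have : ray p x0 (x0, p x0) by exists 1 => //=; rewrite scale1r mul1r.
move=> /(inf_conv_opp sp Vx0) /=; have := gp (- x0).
have := lg (- 1) x0 0; rewrite scaleN1r addr0 (sublinear0 _ sg) addr0 => ->.
rewrite scaleN1r => ? ?; lra.
Qed.

End Sublinear.

(** * Consequences for the dual of a normed space *)
Section NormedHahnBanach.
Context {R : realType} {E : normedModType R}.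

Lemma dual_of_le_norm (g : E -> R^o) : linear g -> (forall x, g x <= `|x|) ->
  exists h : dual E, forall x, h x = g x.
Proof.
move=> lg gn.
pose L := GRing.isLinear.Build R E R^o *:%R g lg.
pose gL : {linear E -> R^o} := HB.pack g L.
have gN x : g (- x) = - g x by exact: (raddfN gL).
suff gP : g \in @dual_pred R E by exists (Dual gP).
apply/dual_predP; split => //.
apply: (@bounded_linear_continuous _ _ _ gL).
apply/bounded_funP => r; exists r => x xr.
apply: le_trans xr; rewrite ler_norml gn andbT.
by have := gn (- x); rewrite gN normrN lerNl.
Qed.

Lemma hahn_banach_dual (p : E -> R) (x0 : E) : sublinear p ->
  (forall x, p x <= `|x|) ->
  exists g : dual E, (forall x, g x <= p x) /\ g x0 = p x0.
Proof.
move=> sp pn; have [g [lg gp gx0]] := hahn_banach_sublinear p x0 sp.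
have [h hg] := dual_of_le_norm g lg (fun x => le_trans (gp x) (pn x)).
by exists h; split=> [x|]; rewrite hg.
Qed.

Lemma sublinear_norm : sublinear (fun x : E => `|x|).
Proof.
split=> [x y|t x t0]; first exact: ler_normD.
by rewrite normrZ ger0_norm.
Qed.

Lemma norming_functional (d : E) :
  exists g : dual E, (forall x, g x <= `|x|) /\ g d = `|d|.
Proof. exact: (hahn_banach_dual _ d sublinear_norm). Qed.

(** The pairs (coefficient, index) may repeat an index, so that sums of
    combinations are concatenations, and rational combinations form a countable
    type. *)
Definition comb (x : nat -> E) (s : seq (R * nat)) : E :=
  \sum_(a <- s) a.1 *: x a.2.

Lemma comb_cons x a s : comb x (a :: s) = a.1 *: x a.2 + comb x s.
Proof. exact: big_cons. Qed.

Lemma comb_cat x s t : comb x (s ++ t) = comb x s + comb x t.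
Proof. exact: big_cat. Qed.

Lemma comb_scale x t s :
  comb x [seq (t * a.1, a.2) | a <- s] = t *: comb x s.
Proof.
rewrite /comb big_map scaler_sumr; apply: eq_bigr => a _.
by rewrite scalerA.
Qed.

(** Applied to the distance to the linear span of the [x n], Hahn-Banach gives
    a functional that vanishes on every [x n] and whose value at [y] is the
    distance from [y] to the span; by hypothesis that distance is zero. *)
Lemma closure_span_of_dual (x : nat -> E) (y : E) :
  (forall g : dual E, (forall n, g (x n) = 0) -> g y = 0) ->
  forall eps : R, 0 < eps -> exists s, `|y - comb x s| < eps.
Proof.
move=> xy eps eps0.
pose V : set (E * R) := [set (comb x s, 0) | s in setT].
have mV : cone_minorant (fun z : E => `|z|) V.
  split.
  - by exists [::] => //; rewrite /comb big_nil.
  - move=> _ _ [s _ <-] [t _ <-]; exists (s ++ t) => //=.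
    by rewrite comb_cat addr0.
  - move=> t _ t0 [s _ <-]; exists [seq (t * a.1, a.2) | a <- s] => //=.
    by rewrite comb_scale mulr0.
  - by move=> _ [s _ <-]; exact: normr_ge0.
have [g [gp gy]] := hahn_banach_dual _ y (inf_conv_sublinear sublinear_norm mV)
  (inf_conv_le_self sublinear_norm mV).
have gx n : g (x n) = 0.
  have gle t : g (t *: x n) <= 0.
    apply: le_trans (gp _) _.
    have Vt : V (- t *: x n, 0) by exists [:: (- t, n)] => //; rewrite /comb big_seq1.
    have := inf_conv_le sublinear_norm mV (t *: x n) _ Vt.
    by rewrite /= scaleNr subrr normr0 subr0.
  have := gle 1; have := gle (- 1).
  by rewrite scaleN1r scale1r linearN => ? ?; apply/eqP; rewrite eq_le; lra.
have p0 : inf_conv (fun z : E => `|z|) V y = 0 by rewrite -gy xy.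
apply: contrapT => /forallNP far.
have : eps <= inf_conv (fun z : E => `|z|) V y.
  apply: (le_inf_conv mV) => _ [s _ <-] /=; rewrite subr0 leNgt.
  apply/negP => ys; apply: (far [seq (- 1 * a.1, a.2) | a <- s]).
  by rewrite comb_scale scaleN1r opprK.
by rewrite p0 leNgt eps0.
Qed.

Definition rat_comb (x : nat -> E) (s : seq (rat * nat)) : E :=
  comb x [seq (ratr a.1, a.2) | a <- s].

Lemma rat_comb_dense (x : nat -> E) (s : seq (R * nat)) (eps : R) : 0 < eps ->
  exists q : seq (rat * nat), `|comb x s - rat_comb x q| < eps.
Proof.
elim: s eps => [|[c n] s IHs] eps eps0.
  by exists [::]; rewrite /rat_comb /comb !big_nil subrr normr0.
have e20 : 0 < eps / 2 by rewrite divr_gt0.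
have [q sq] := IHs _ e20.
have d0 : 0 < eps / 2 / (`|x n| + 1).
  by rewrite !divr_gt0// ltr_wpDl.
have [|r] := @rat_in_itvoo R c (c + eps / 2 / (`|x n| + 1)).
  by rewrite ltrDl.
rewrite in_itv /= => /andP[cr rc].
exists ((r, n) :: q); rewrite /rat_comb /= !comb_cons /= opprD addrACA -scalerBl.
rewrite (le_lt_trans (ler_normD _ _))// (splitr eps) ler_ltD// normrZ.
rewrite distrC gtr0_norm ?subr_gt0//.
have H : ratr r - c <= eps / 2 / (`|x n| + 1) by rewrite lerBlDl ltW.
apply: le_trans (ler_wpM2r (normr_ge0 _) H) _.
rewrite -[leLHS]mulrA (ler_piMr (ltW e20))//.
by rewrite mulrC ler_pdivrMr ?mul1r ?lerDl// ltr_wpDl.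
Qed.

(** Finitely many functionals cut out a subspace of finite codimension. When a
    new functional [g] does not vanish on the common kernel of the previous
    ones, adding a single vector [z] of that kernel with [g z <> 0] suffices:
    multiples of [z] correct the value of [g] and leave the others unchanged. *)
Lemma spanning_modulo_kernels (gs : seq (dual E)) :
  exists es : seq E, forall x, exists c : nat -> R,
    forall g : dual E, g \in gs ->
      g (x - \sum_(i < size es) c i *: es`_i) = 0.
Proof.
elim: gs => [|g gs [es esP]]; first by exists [::] => x; exists (fun=> 0).
have [gK|/existsNP[z /not_implyP[gsz gz]]] := pselect (forall z,
    (forall h : dual E, h \in gs -> h z = 0) -> g z = 0).
  exists es => x; have [c cP] := esP x; exists c => h; rewrite inE.
  by move=> /predU1P[->|]; [apply: gK|]; exact: cP.
exists (z :: es) => x; have [c cP] := esP x.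
set y := x - _ in cP.
exists (fun i => if i is j.+1 then c j else g y / g z) => h.
rewrite /= big_ord_recl /= opprD addrCA -/y addrC linearB linearZ /= inE.
case/predU1P => [->|hgs]; last by rewrite (cP h hgs) (gsz h hgs) scaler0 subr0.
by apply/eqP; rewrite subr_eq0; apply/eqP; rewrite -[RHS]/(_ * _) divfK//; apply/eqP.
Qed.

(** * A weakly null sequence of unit vectors *)
Lemma unit_vector_in_kernels (gs : seq (dual E)) : ~ finite_dimensional E ->
  exists z : E, `|z| = 1 /\ forall g : dual E, g \in gs -> g z = 0.
Proof.
move=> infE.
have [[z [z0 gz]]|noz] := pselect (exists z : E, z != 0 /\
    forall g : dual E, g \in gs -> g z = 0).
  exists (`|z|^-1 *: z); split=> [|g ggs].
    by rewrite normrZ normfV normr_id mulVf// normr_eq0.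
  by rewrite linearZ /= gz// scaler0.
case: infE; have [es esP] := spanning_modulo_kernels gs.
exists (size es), (fun i => es`_i) => x; have [c cP] := esP x.
exists (fun i => c i); apply/eqP; rewrite -subr_eq0; apply: contrapT => /negP y0.
by apply: noz; eexists; split; [exact: y0|exact: cP].
Qed.

(** At stage [n], only finitely many rational combinations of the previous
    vectors have code below [n], so that a unit vector annihilated by their
    functionals exists. Each fixed combination is taken into account from some
    stage on. *)
Lemma eventually_annihilated_sequence (N : E -> dual E) :
  ~ finite_dimensional E ->
  exists x : nat -> E, (forall n, `|x n| = 1) /\
    forall q, \forall n \near \oo, N (rat_comb x q) (x n) = 0.
Proof.
move=> infE.
(* An index beyond [s] reads the default vector 0; a combination [q] has its
   final value as soon as [s] is longer than all its indices. *)
pose gs (s : seq E) : seq (dual E) :=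
  [seq N (rat_comb (nth 0 s) q) | q <- pmap unpickle (iota 0 (size s))].
have /choice[step stepP] := fun s => unit_vector_in_kernels (gs s) infE.
pose pre := fix pre n := if n is m.+1 then rcons (pre m) (step (pre m)) else [::].
pose x n := step (pre n).
have size_pre n : size (pre n) = n by elim: n => //= n IHn; rewrite size_rcons IHn.
have nth_pre n i : (i < n)%N -> nth 0 (pre n) i = x i.
  elim: n => // n IHn; rewrite ltnS leq_eqVlt /= nth_rcons size_pre.
  by case/predU1P => [->|i_lt]; [rewrite ltnn eqxx|rewrite i_lt IHn].
exists x; split=> [n|q]; first by have [] := stepP (pre n).
have [M qM] : exists M, all (fun a => a.2 < M)%N q.
  elim: q => [|a q [M qM]]; first by exists 0%N.
  exists (maxn a.2.+1 M) => /=; rewrite leq_max leqnn /=.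
  by apply: sub_all qM => b /= bM; rewrite leq_max bM orbT.
(* Two conditions on [n]: the indices in [q] are among the vectors already
   chosen, and the code of [q] has been reached. *)
exists (maxn M (pickle q).+1) => // n /=; rewrite geq_max => /andP[Mn qn].
have -> : rat_comb x q = rat_comb (nth 0 (pre n)) q.
  rewrite /rat_comb /comb !big_map; apply: eq_big_seq => a aq /=.
  by rewrite nth_pre// (leq_trans _ Mn)//; exact: (allP qM).
have [_] := stepP (pre n); apply; apply/mapP; exists q => //.
by rewrite mem_pmap; apply/mapP; exists (pickle q); rewrite ?pickleK// mem_iota size_pre.
Qed.

(** Along an ultrafilter every bounded real sequence converges, so that
    [g |-> lim g (x n)] is a bounded functional on the dual; reflexivity
    represents it by a vector. This replaces weak compactness of the ball. *)
Lemma ultrafilter_weak_limit (x : nat -> E) (U : set_system nat) :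
  reflexive_space E -> UltraFilter U -> (forall n, `|x n| <= 1) ->
  exists y : E, forall g : dual E, g (x n) @[n --> U] --> g y.
Proof.
move=> reflE UU x1.
have lim_ex (g : dual E) : exists l : R^o,
    (g (x n) @[n --> U] --> l) /\ `|l| <= `|g|.
  have gx n : `|g (x n)| <= `|g| by exact: dual_norm_ub.
  pose F : set_system R := (g \o x) @ U.
  have [|l [lg Fl]] := @segment_compact R (- `|g|) `|g| F _.
    rewrite /F /fmap /=; apply: filterE => n; rewrite /= in_itv /= -ler_norml.
    exact: gx.
  exists l; split; last by rewrite ler_norml; move: lg; rewrite /= in_itv.
  move=> B Bl; have [//|nB] := in_ultra_setVsetC ((g \o x) @^-1` B) UU.
  by have [r []] := Fl (~` B) B nB Bl.
have /choice[phi phiP] := lim_ex.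
have phi_lin : linear phi.
  move=> a g h; apply: (@cvg_unique _ _ ((a *: g + h) (x n) @[n --> U])) => //.
    exact: (phiP _).1.
  by apply: cvgD; [apply: cvgZl_tmp; exact: (phiP g).1|exact: (phiP h).1].
pose L := GRing.isLinear.Build R (dual E) R^o *:%R phi phi_lin.
pose phiL : {linear dual E -> R^o} := HB.pack phi L.
have phi_dual : phi \in @dual_pred R (dual E).
  apply/dual_predP; split => //.
  apply: (@bounded_linear_continuous _ _ _ phiL).
  by apply/bounded_funP => r; exists r => g gr; exact: le_trans (phiP g).2 gr.
have [y yP] := reflE (Dual phi_dual); exists y => g.
have -> : g y = phi g by rewrite -[LHS]/(canonical_embedding y g) yP.
exact: (phiP g).1.
Qed.

(** Let [N d] be a norming functional of [d], and choose [x] so that [N d] is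
    eventually zero along [x] for each rational combination [d] of the [x n].
    If [g (x n)] did not tend to 0, an ultrafilter concentrated on the indices
    where it stays large would provide a weak limit [y] with [g y != 0].
    But [y] lies in the closed linear span of the [x n] and every [N d] vanishes
    at [y]; for [d] close to [y], [|d| = N d (d - y)] is small, so [y = 0]. *)
Lemma weakly_null_unit_sequence :
  ~ finite_dimensional E -> reflexive_space E ->
  exists x : nat -> E, (forall n, `|x n| = 1) /\ weakly_cvg x 0.
Proof.
move=> infE reflE.
have /choice[N NP] := norming_functional.
have [x [x1 xN]] := eventually_annihilated_sequence N infE.
exists x; split=> // g; rewrite linear0; apply/cvgr0Pnorm_lt => eps eps0.
apply: contrapT => gx.
pose A := [set n | ~ `|g (x n)| < eps].
have FA : ProperFilter (within A \oo).
  apply: Build_ProperFilter_ex => B AB; apply: contrapT => /forallNP B0.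
  apply: gx; have {}AB : \oo (fun n => A n -> B n) := AB.
  by apply: filterS AB => n AB; apply: contrapT => /AB/B0.
have [U [UU AU]] := ultraFilterLemma FA.
have ooU : \oo `<=` U by move=> B ooB; apply: AU; apply: filterS ooB => n Bn _.
have UA : U A by apply: AU; exact: withinT.
have [|y yP] := ultrafilter_weak_limit x U reflE UU; first by move=> n; rewrite x1.
have lim0 (h : dual E) : (\forall n \near \oo, h (x n) = 0) -> h y = 0.
  move=> hx; apply: (@norm_cvg_unique _ _ (h (x n) @[n --> U])).
    exact: yP.
  apply: cvg_near_cst; apply: ooU; exact: hx.
have Ny q : N (rat_comb x q) y = 0 := lim0 _ (xN q).
have closure_y : forall e : R, 0 < e -> exists s, `|y - comb x s| < e.
  by apply: closure_span_of_dual => h hx; apply: lim0; exists 0%N => // n _.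
have y0 : y = 0.
  apply/eqP; rewrite -normr_le0; apply/ler_addgt0Pr => e e0; rewrite add0r.
  have e40 : 0 < e / 4 by rewrite divr_gt0.
  have [s ys] := closure_y _ e40.
  have [q sq] := rat_comb_dense x s _ e40.
  have yq : `|y - rat_comb x q| < e / 2.
    have := ler_normD (y - comb x s) (comb x s - rat_comb x q).
    by rewrite addrA subrK => ?; lra.
  have [Nle Nd] := NP (rat_comb x q).
  have := Nle (rat_comb x q - y); rewrite linearB /= Nd Ny subr0 distrC => dle.
  have := ler_normD (y - rat_comb x q) (rat_comb x q); rewrite subrK; lra.
have Ueps : U [set n | `|g (x n)| < eps].
  have := yP g; rewrite y0 linear0 => /cvgr0Pnorm_lt; exact.
by have [n [An]] := filter_ex (filterI UA Ueps).
Qed.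

End NormedHahnBanach.

(** * The distance to a weakly null sequence *)
Section DistanceFunction.
Context {R : realType} {E : normedModType R} (x : nat -> E).

Definition dist_range (y : E) : R := inf [set `|y - x n| | n in setT].

Lemma dist_range_le y n : dist_range y <= `|y - x n|.
Proof. by apply: ge_inf; [exists 0 => _ [m _ <-]|exists n]. Qed.

Lemma le_dist_range y r : (forall n, r <= `|y - x n|) -> r <= dist_range y.
Proof.
by move=> ry; apply: lb_le_inf => [|_ [n _ <-]//]; exists `|y - x 0|, 0%N.
Qed.

Lemma dist_range_lipschitz : lipschitz (dist_range : E -> R^o).
Proof.
have le1 y z : dist_range y - dist_range z <= `|y - z|.
  rewrite lerBlDr -lerBlDl; apply: le_dist_range => n; rewrite lerBlDl.
  apply: le_trans (dist_range_le y n) _.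
  by have := ler_normD (y - z) (z - x n); rewrite addrA subrK.
apply: (@klipschitzW _ _ _ 1).
  exact: (@globally_properfilter _ _ (0, 0)).
move=> [y z] _ /=; rewrite mul1r ler_norml le1 andbT.
by rewrite lerNl opprB distrC.
Qed.

#[local] Instance norm_pinfty_filter : Filter (@norm_pinfty R E).
Proof.
apply: filter_from_filter; first by exists 0.
move=> r s _ _; exists (Num.max r s) => // y /=.
by rewrite gt_max => /andP[].
Qed.

Lemma dist_range_coercive : (forall n, `|x n| <= 1) -> coercive dist_range.
Proof.
move=> x1; apply/cvgryPge => A; exists (A + 1) => // y /= Ay.
apply: le_dist_range => n; have := ler_normD (y - x n) (x n); rewrite subrK.
by have := x1 n; lra.
Qed.

(** The function is zero at each [x n] but equals one at their weak limit. *)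
Lemma dist_range_not_swlsc : weakly_cvg x 0 -> (forall n, `|x n| = 1) ->
  ~ swlsc dist_range.
Proof.
move=> x0 x1 /(_ 0 x x0).
have -> : (fun n => (dist_range (x n))%:E) = cst 0%E.
  apply/funext => n; congr (_%:E); apply/eqP; rewrite eq_le.
  apply/andP; split; last exact: le_dist_range.
  by have := dist_range_le (x n) n; rewrite subrr normr0.
rewrite is_cvg_limn_einfE; last exact: is_cvg_cst.
rewrite lim_cst// lee_fin leNgt => /negP; apply.
apply: (lt_le_trans ltr01); apply: le_dist_range => n.
by rewrite sub0r normrN x1.
Qed.

End DistanceFunction.

Theorem corollary1p10 (R : realType) (E : completeNormedModType R)
    (infinite_dim : ~ finite_dimensional E) (reflE : reflexive_space E) :
  exists f : E -> R, [/\ coercive f, lipschitz f & ~ swlsc f].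
Proof.
have [x [x1 x0]] := weakly_null_unit_sequence infinite_dim reflE.
exists (dist_range x); split; last exact: dist_range_not_swlsc.
- by apply: dist_range_coercive => n; rewrite x1.
- exact: dist_range_lipschitz.
Qed.
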